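(* Let $A$ be a unital Banach $\star$-algebra with unity $1$, let $z \in A$ be fixed, let $X$ be a Banach space, and let $\phi : A \times A \to X$ be a continuous bilinear map such that \[ \phi(a^\star, b) = \phi(z, 1) \quad \text{for all } a, b \in A \text{ with } a^\star b = z. \] Then \[ \phi(za, a) = \phi(z a^2, 1) \quad \text{and} \quad \phi(za, 1) = \phi(z, a) \quad \text{for all } a \in A, \] and there exists a continuous linear map $\Phi : A \to X$ such that \[ \phi(za, b) + \phi(zb, a) = \Phi(a \circ b) \quad \text{for all } a, b \in A. \]
   Context: Algebras and Banach spaces are over $\mathbb{C}$; $a \mapsto a^\star$ denotes the involution of $A$ (conjugate-linear, anti-multiplicative, and $(a^\star)^\star = a$). The Jordan product on $A$ is $a \circ b = ab + ba$. *)

(* Defs.v *)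
From HB Require Import structures.
From mathcomp Require Import all_boot all_order all_algebra.
From mathcomp Require Import all_classical all_reals all_analysis.
From mathcomp.real_closed Require Export complex.

Set Implicit Arguments.
Unset Strict Implicit.
Unset Printing Implicit Defensive.

Import GRing.Theory Num.Theory numFieldNormedType.Exports.
Local Open Scope ring_scope.

(* A structure inheriting from both GRing.PzSemiRing and a normed module is
   rejected by Hierarchy Builder (NumDomain would have to be below the join).
   The multiplication is therefore a mixin over completeNormedModType, and the
   ring structure is put afterwards on the carrier of a banachAlgType.  Neither
   1 != 0 nor `|1| = 1 is required. *)
HB.mixin Record CompleteNormedModule_isBanachAlgebra (K : numFieldType) A
    of CompleteNormedModule K A := {
  banach_one : A;
  banach_mul : A -> A -> A;
  banach_mulA : associative banach_mul;
  banach_mul1 : left_id banach_one banach_mul;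
  banach_mulr1 : right_id banach_one banach_mul;
  banach_mulDl : left_distributive banach_mul +%R;
  banach_mulDr : right_distributive banach_mul +%R;
  banach_scaleAl : forall (k : K) (a b : A),
    k *: banach_mul a b = banach_mul (k *: a) b;
  banach_scaleAr : forall (k : K) (a b : A),
    k *: banach_mul a b = banach_mul a (k *: b);
  banach_normM : forall a b : A, `|banach_mul a b| <= `|a| * `|b| }.

#[short(type="banachAlgType")]
HB.structure Definition BanachAlgebra (K : numFieldType) :=
  {A of CompleteNormedModule K A & CompleteNormedModule_isBanachAlgebra K A}.

#[non_forgetful_inheritance]
HB.instance Definition _ (K : numFieldType) (A : banachAlgType K) :=
  GRing.Zmodule_isPzRing.Build (BanachAlgebra.sort A)
    (@banach_mulA K A) (@banach_mul1 K A) (@banach_mulr1 K A)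
    (@banach_mulDl K A) (@banach_mulDr K A).

Definition is_involution (C : numClosedFieldType) (A : banachAlgType C)
    (star : A -> A) : Prop :=
  [/\ forall a b : A, star (a + b) = star a + star b,
      forall (k : C) (a : A), star (k *: a) = k^* *: star a,
      forall a b : A, star (a * b) = star b * star a &
      forall a : A, star (star a) = a].

Definition jordan_mul (R : pzRingType) (a b : R) : R := a * b + b * a.

(* Main.v *)
Require Import Defs.
From mathcomp Require Import all_boot all_order all_algebra.
From mathcomp Require Import all_classical all_reals all_analysis.
Import Order.TTheory GRing.Theory Num.Theory.
Import numFieldNormedType.Exports.
Local Open Scope classical_set_scope.
Local Open Scope ring_scope.

(** Every element of [A] is of the form [star a], so the hypothesis says that
    [phi x y = phi z 1] whenever [x * y = z].  Such factorizations of [z] are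
    supplied by small perturbations of [1]: for small [t] the Neumann series
    gives [w] with [w = 1 + t *: (a * w)], that is [(1 - t *: a) * w = 1]
    ([one_sub_right_inverse]), and then [(z - t *: (z * a)) * w = z].
    Expanding [phi (z - t *: (z * a)) w = phi z 1] with the equation of [w] and
    dividing by [t] leaves the exact identity
      [phi z (a * w) = phi (z * a) w].
    As [t] tends to [0], [w] tends to [1] ([resolvent_limit]), which gives
    [phi z a = phi (z * a) 1].  Substituting [w = 1 + t *: (a * w)] once more
    in the exact identity, cancelling the terms just shown to be equal and
    dividing by [t] again gives [phi z (a * (a * w)) = phi (z * a) (a * w)],
    whose limit is [phi z (a ^+ 2) = phi (z * a) a].  In effect this compares
    the first two Taylor coefficients of a constant function of [t], without
    any power series.

    The Jordan product identity is the polarization of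
    [phi (z * a) a = phi z (a ^+ 2)], with [phi z] as the map [Phi]. *)

Lemma banach_normrM (K : numFieldType) (A : banachAlgType K) (a b : A) :
  `|a * b| <= `|a| * `|b|.
Proof. exact: banach_normM. Qed.

Lemma banach_scalerAl (K : numFieldType) (A : banachAlgType K) (k : K)
    (a b : A) : k *: (a * b) = k *: a * b.
Proof. exact: banach_scaleAl. Qed.

Lemma banach_scalerAr (K : numFieldType) (A : banachAlgType K) (k : K)
    (a b : A) : k *: (a * b) = a * (k *: b).
Proof. exact: banach_scaleAr. Qed.

Lemma banach_mull_continuous (K : numFieldType) (A : banachAlgType K) (a : A) :
  continuous (fun b : A => a * b).
Proof.
move=> b; apply/cvgrPdist_lt => e e_gt0; near=> c.
rewrite -mulrBr (le_lt_trans (banach_normrM _ _ _ _))//.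
have a1 : 0 < `|a| + 1 by rewrite ltr_wpDl.
apply: (@le_lt_trans _ _ ((`|a| + 1) * `|b - c|)).
  by rewrite ler_wpM2r// lerDl.
rewrite -ltr_pdivlMl//.
by near: c; apply: cvgr_dist_lt => //; rewrite mulrC divr_gt0.
Unshelve. all: by end_near. Qed.

(** A positive complex number is real, so this reduces to the archimedean
    property of [R]. *)
Lemma exp_half_lt (R : realType) (e : R[i]) :
  0 < e -> exists n : nat, 2^-1 ^+ n < e.
Proof.
case: e => x y; rewrite ltcE/= => /andP[/eqP -> x_gt0].
have [n n_gt] : exists n : nat, x^-1 < n%:R.
  by exists (Num.bound x^-1); rewrite archi_boundP// invr_ge0 ltW.
have ltn2 : (n%:R : R) < 2 ^+ n by rewrite -natrX ltr_nat ltn_expl.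
have : 2^-1 ^+ n < x.
  by rewrite exprVn invf_plt ?posrE ?exprn_gt0// (lt_trans n_gt).
rewrite -ltcR rmorphXn fmorphV rmorph_nat => half_lt.
by exists n.
Qed.

(** The partial sums of the Neumann series are the iterates [s n] of
    [x |-> 1 + b * x] from [0].  They are bounded by [2 * `|1|], and since
    [s (n + k) - s n] is [b] times [s (n.-1 + k) - s n.-1], they form a Cauchy
    sequence; the limit is the fixed point. *)
Lemma one_sub_right_inverse (R : realType) (A : banachAlgType R[i]) (b : A) :
  `|b| <= 2^-1 -> exists w : A, w = 1 + b * w.
Proof.
move=> b_half.
pose s n := iter n (fun x : A => 1 + b * x) 0.
have half_le (x : A) : `|b * x| <= 2^-1 * `|x|.
  by rewrite (le_trans (banach_normrM _ _ _ _))// ler_wpM2r.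
have s_bound n : `|s n| <= 2 * `|1 : A|.
  elim: n => [|n IHn] /=; first by rewrite normr0 mulr_ge0.
  rewrite (le_trans (ler_normD _ _))// mulr_natl mulr2n lerD2l.
  by rewrite (le_trans (half_le _))// ler_pdivrMl.
have sS n : s n.+1 = 1 + b * s n by [].
have s_dist n k : `|s (n + k)%N - s n| <= 2^-1 ^+ n * (2 * `|1 : A|).
  elim: n => [|n IHn]; first by rewrite add0n subr0 expr0 mul1r.
  rewrite addSn !sS opprD addrACA subrr add0r -mulrBr.
  by rewrite (le_trans (half_le _))// exprS -mulrA ler_wpM2l.
have : cvg (s n @[n --> \oo]).
  apply/cauchy_cvgP/cauchy_exP => e e_gt0.
  (* [+ 1] keeps the divisor positive when [A] is the zero algebra *)
  have c_gt0 : 0 < 2 * `|1 : A| + 1 by rewrite ltr_wpDl// mulr_ge0.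
  have [n n_lt] := @exp_half_lt R _ (divr_gt0 e_gt0 c_gt0).
  exists (s n); exists n => // m /= /subnKC <-.
  rewrite -ball_normE /= distrC (le_lt_trans (s_dist _ _))//.
  move: n_lt; rewrite ltr_pdivlMr//; apply: le_lt_trans.
  by rewrite ler_wpM2l ?exprn_ge0// lerDl.
move=> /cvg_ex[w sw]; exists w.
have sw1 : s n.+1 @[n --> \oo] --> w by rewrite (cvg_shiftS s).
apply: (cvg_unique _ sw1); first exact: norm_hausdorff.
apply: cvgD; first exact: cvg_cst.
exact: (cvg_comp _ _ sw (@banach_mull_continuous _ A b w)).
Qed.

(** Any solution [w] of [w = 1 + t *: (a * w)] has norm at most [2 * `|1|] once
    [`|t *: a| <= 2^-1], so [w - 1 = t *: (a * w)] tends to [0] with [t].  An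
    equation that holds at all solutions with [t != 0] thus passes to [1]. *)
Lemma resolvent_limit (R : realType) (A : banachAlgType R[i])
    (X : normedModType R[i]) (a : A) (g : A -> X) :
  {for 1, continuous g} ->
  (forall (t : R[i]) (w : A), t != 0 -> w = 1 + t *: (a * w) -> g w = 0) ->
  g 1 = 0.
Proof.
move=> g_cont g0; apply/eqP; apply: contraT => g1.
have /nbhs_ballP[e /= e_gt0 be] : \forall x \near (1 : A), g x != 0.
  exact: cvgr_neq0 g_cont g1.
have pa : 0 < 1 + `|a| by rewrite ltr_pwDl.
have p2 : 0 < 1 + 2 * `|1 : A| by rewrite ltr_pwDl ?mulr_ge0.
near (0 : R[i]^o)^' => t.
have t0 : t != 0 by near: t; exact: nbhs_dnbhs_neq.
have ta (d : R[i]) : `|t| < d / (1 + `|a|) -> `|t *: a| <= d.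
  rewrite ltr_pdivlMr// => /ltW; apply: le_trans.
  by rewrite normrZ ler_wpM2l// lerDr.
have ta_half : `|t *: a| <= 2^-1.
  by apply: ta; near: t; apply: dnbhs0_lt; rewrite divr_gt0.
have ta_e : `|t *: a| <= e / (1 + 2 * `|1 : A|).
  by apply: ta; near: t; apply: dnbhs0_lt; rewrite !divr_gt0.
have [w wE] := @one_sub_right_inverse R A _ ta_half.
have w_le : `|w| <= 2 * `|1 : A|.
  have w_half : `|w| <= `|1 : A| + 2^-1 * `|w|.
    rewrite {1}wE (le_trans (ler_normD _ _))// lerD2l.
    by rewrite (le_trans (banach_normrM _ _ _ _))// ler_wpM2r.
  rewrite -ler_pdivrMl// -(lerD2r (2^-1 * `|w|)) -mulrDl.
  by rewrite -[2^-1 + 2^-1]mulr2n -[_ *+ 2]mulr_natr mulVf// mul1r.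
have : ball (1 : A) e w.
  rewrite -ball_normE /= distrC {1}wE addrAC subrr add0r.
  rewrite (le_lt_trans (banach_normrM _ _ _ _))//.
  rewrite (le_lt_trans (ler_pM _ _ ta_e w_le))//.
  by rewrite mulrAC ltr_pdivrMr// ltr_pM2l// ltrDr.
rewrite -banach_scalerAl in wE.
by move/be; rewrite /= (g0 t w)// eqxx.
Unshelve. all: by end_near. Qed.

Theorem theorem3p2 (R : realType) (A : banachAlgType R[i])
    (star : A -> A) (star_inv : is_involution star) (z : A)
    (X : completeNormedModType R[i]) (phi : {bilinear A -> A -> X})
    (phi_cont : continuous (fun p : A * A => phi p.1 p.2))
    (phi_z : forall a b : A, star a * b = z -> phi (star a) b = phi z 1) :
  [/\ forall a : A, phi (z * a) a = phi (z * a ^+ 2) 1,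
      forall a : A, phi (z * a) 1 = phi z a &
      exists Phi : {linear A -> X}, continuous Phi /\
        forall a b : A, phi (z * a) b + phi (z * b) a = Phi (jordan_mul a b)].
Proof.
have phi_fact (x y : A) : x * y = z -> phi x y = phi z 1.
  by case: star_inv => _ _ _ starK; rewrite -[x]starK; exact: phi_z.
have phi_contr (x : A) : continuous (phi x : A -> X).
  move=> y.
  apply: (@continuous_comp _ _ _ (fun y : A => (x, y))
                                 (fun p : A * A => phi p.1 p.2)).
    by apply: cvg_pair; [exact: cvg_cst|exact: cvg_id].
  exact: phi_cont.
have phi_mull_cont (x b : A) : continuous (fun y : A => phi x (b * y)).
  move=> y; apply: continuous_comp; first exact: banach_mull_continuous.
  exact: phi_contr.
have phi_w (a w : A) (t : R[i]) : t != 0 -> w = 1 + t *: (a * w) ->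
    phi z (a * w) = phi (z * a) w.
  move=> t0 wE.
  have : phi (z - t *: (z * a)) w = phi z 1.
    apply: phi_fact; rewrite mulrBl -banach_scalerAl -mulrA banach_scalerAr.
    by rewrite -mulrBr {1}wE addrK mulr1.
  rewrite linearBl linearZl_LR /= {1}wE linearDr linearZr_LR /=.
  rewrite -addrA -scalerBr -[RHS]addr0 => /addrI/eqP.
  by rewrite scaler_eq0 (negPf t0) subr_eq0 => /eqP.
have phi1 (a : A) : phi (z * a) 1 = phi z a.
  suff: phi z (a * 1) - phi (z * a) 1 = 0 by rewrite mulr1 => /subr0_eq.
  apply: (@resolvent_limit R A X a (fun y => phi z (a * y) - phi (z * a) y)).
    by apply: cvgB; [exact: phi_mull_cont|exact: phi_contr].
  by move=> t w t0 /(phi_w a w t t0) ->; rewrite subrr.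
have phi2 (a : A) : phi (z * a) a = phi (z * a ^+ 2) 1.
  suff: phi z (a * a * 1) - phi (z * a) (a * 1) = 0.
    by rewrite !mulr1 phi1 expr2 => /subr0_eq.
  apply: (@resolvent_limit R A X a
            (fun y => phi z (a * a * y) - phi (z * a) (a * y))).
    by apply: cvgB; exact: phi_mull_cont.
  move=> t w t0 wE; have := phi_w a w t t0 wE.
  (* the terms of order [0] in [t] cancel by [phi1] *)
  rewrite {1 2}wE mulrDr mulr1 !linearDr /= phi1 => /addrI.
  rewrite -banach_scalerAr !linearZr_LR /= mulrA => /(scalerI t0) ->.
  by rewrite subrr.
split=> //; exists (phi z : {linear A -> X}).
split=> [|a b]; first exact: phi_contr.
have := phi2 (a + b).
rewrite [(a + b) ^+ 2]expr2 !mulrDl !mulrDr !linearDl /= !linearDr /= !phi2.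
rewrite -!expr2.
by rewrite -!addrA => /addrI; rewrite !addrA => /addIr ->; rewrite !phi1.
Qed.
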